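(* (Cancellation law) Let $C\subset\mathbb{R}^d$ be a fixed nonempty closed convex cone with $\{\mathbf 0\}\neq C\neq\mathbb{R}^d$. Let $A,B,D\subseteq\mathbb{R}^d$ be nonempty closed convex sets with $A=\overline{A+C}$, $B=\overline{B+C}$, $D=\overline{D+C}$, and suppose that $B$ has a compact component, i.e. $B=\tilde B+C$ for some nonempty compact convex set $\tilde B\subset\mathbb{R}^d$. Then $A\oplus B=D\oplus B$ implies $A=D$.
   Context: A cone is a set $C\subseteq\mathbb{R}^d$ with $\alpha x\in C$ for all $\alpha>0$, $x\in C$. $A+B=\{a+b:a\in A,b\in B\}$ is Minkowski addition, the overline denotes closure, and $A\oplus B:=\overline{A+B}$. *)

(* Defs.v *)
From mathcomp Require Import all_boot all_order all_algebra.
From mathcomp Require Import all_classical all_reals all_analysis.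

Set Implicit Arguments.
Unset Strict Implicit.
Unset Printing Implicit Defensive.

Import Order.TTheory GRing.Theory Num.Theory.
Import numFieldNormedType.Exports.

Local Open Scope classical_set_scope.
Local Open Scope ring_scope.

Definition minkowski_sum (V : zmodType) (A B : set V) : set V :=
  [set a + b | a in A & b in B].

(* Without the closure, the sum of two closed sets need not be closed. *)
Definition closed_minkowski_sum (R : realType) (d : nat)
    (A B : set 'rV[R]_d) : set 'rV[R]_d :=
  closure (minkowski_sum A B).

(* The scaling factor is strictly positive, so [0 \in C] is not imposed. *)
Definition cone (R : numDomainType) (V : lmodType R) (C : set V) : Prop :=
  forall (alpha : R) (x : V), 0 < alpha -> C x -> C (alpha *: x).

Definition has_compact_component (R : realType) (d : nat)
    (C B : set 'rV[R]_d) : Prop :=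
  exists B' : set 'rV[R]_d,
    [/\ B' !=set0, compact B', convex_set B' & B = minkowski_sum B' C].

(* Main.v *)
Require Import Defs.
From mathcomp Require Import all_boot all_order all_algebra.
From mathcomp Require Import all_classical all_reals all_analysis.
From mathcomp Require Import lra.

Import Order.TTheory GRing.Theory Num.Theory.
Import numFieldNormedType.Exports.

Local Open Scope classical_set_scope.
Local Open Scope ring_scope.

(** Write [B = K + C] with [K] compact. As [0] lies in [C] and [D] absorbs [C],
    the hypothesis gives [a + K `<=` closure (D + K)] for every [a] in [A].
    Starting from [b_0] in [K], choose [d_i] in [D] and [b_(i+1)] in [K] with
    [a + b_i] within [e] of [d_i + b_(i+1)]. Summing over [i < n] telescopes:
    [a] is within [e + |b_n - b_0| / n] of the mean of the [d_i], which lies in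
    [D] by convexity. As [K] is bounded, [a] lies in [closure D = D]. *)

Lemma convex_set_comb (R : numDomainType) (V : lmodType R) (D : set V) (t : R)
    (x y : V) :
  convex_set D -> 0 <= t <= 1 -> D x -> D y -> D (t *: x + (1 - t) *: y).
Proof.
move=> Dcvx t01 Dx Dy.
move: t01 => /andP[t0 t1].
have := Dcvx x y (Itv01 t0 t1); rewrite !inE; exact.
Qed.

Lemma closure_normP (R : numFieldType) (V : normedModType R) (A : set V) (x : V) :
  closure A x <-> forall e : R, 0 < e -> exists2 y, A y & `|x - y| < e.
Proof.
split=> [clAx e e0|nearA].
  by have [y [Ay]] := clAx _ (nbhsx_ballx x e e0); rewrite -ball_normE; exists y.
move=> U /nbhs_ballP[e /= e0 sU].
have [y Ay xy] := nearA e e0.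
by exists y; split=> //; apply: sU; rewrite -ball_normE.
Qed.

(** Small positive multiples of any point of [C] stay in [C] and tend to [0], so closedness supplies
    the apex that [cone] leaves open. *)
Lemma closed_cone0 (R : numFieldType) (V : normedModType R) (C : set V) :
  C !=set0 -> closed C -> cone C -> C 0.
Proof.
move=> [c Cc] Ccl Ccone; rewrite ((closure_id C).1 Ccl); apply/closure_normP => e e0.
have c1 : 0 < `|c| + 1 by rewrite ltr_wpDl.
(* The summand [1] keeps the denominator positive when [c] is [0]. *)
exists ((e / (`|c| + 1)) *: c); first by apply: Ccone => //; rewrite divr_gt0.
rewrite sub0r normrN normrZ ger0_norm ?divr_ge0 ?ltW// -mulrA gtr_pMr// mulrC.
by rewrite ltr_pdivrMr// mul1r ltrDl.
Qed.

Lemma closure_cancel (R : realType) (V : normedModType R) (D K : set V) (a : V) :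
  convex_set D -> K !=set0 -> bounded_set K ->
  (forall b, K b -> closure (minkowski_sum D K) (a + b)) -> closure D a.
Proof.
move=> Dcvx [b0 Kb0] Kbnd aK.
have [M [_ KM]] := Kbnd.
(* [bounded_set] bounds [K] by each number strictly above [M], and [M] may be negative. *)
have {KM}KM b : K b -> `|b| <= `|M| + 1.
  by apply: KM; rewrite (le_lt_trans (ler_norm M))// ltrDl.
apply/closure_normP => e e0.
have step b : K b -> exists d b', [/\ D d, K b' & `|a + b - (d + b')| < e / 2].
  move=> /aK/closure_normP /(_ (e / 2))[|_ [d Dd [b' Kb' <-]] ?]; first lra.
  by exists d, b'.
(* Here [d] is the mean of [n.+1] chosen points of [D] and [b] the last point reached in [K]. The
   invariant carries only these two, so no sequence has to be built. *)
have telescope n : exists d b, [/\ D d, K b &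
    `|n.+1%:R *: (a - d) + (b0 - b)| <= n.+1%:R * (e / 2)].
  elim: n => [|n [d [b [Dd Kb IH]]]].
    have [d [b [Dd Kb le_e]]] := step _ Kb0.
    exists d, b; split=> //; rewrite scale1r mul1r ltW//.
    by rewrite addrACA -opprD.
  have [d' [b' [Dd' Kb' le_e]]] := step _ Kb.
  have n2 : n.+2%:R != 0 :> R by rewrite pnatr_eq0.
  (* With this weight on the old mean, adding [d'] yields the mean of [n.+2] points. *)
  pose t : R := n.+1%:R / n.+2%:R.
  have nt : n.+2%:R * t = n.+1%:R by rewrite mulrC divfK.
  have nt' : n.+2%:R * (1 - t) = 1.
    by rewrite mulrBr nt mulr1 -[n.+2]add1n natrD addrK.
  exists (t *: d + (1 - t) *: d'), b'; split=> //.
    apply: convex_set_comb => //; rewrite divr_ge0//=.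
    by rewrite ler_pdivrMr// mul1r ler_nat.
  rewrite scalerBr scalerDr !scalerA nt nt' scale1r -[n.+2]addn1 natrD.
  rewrite scalerDl mulrDl scale1r mul1r.
  (* The old error plus the error of the new step: the intermediate point [b] cancels. *)
  rewrite (_ : _ + _ =
    (n.+1%:R *: (a - d) + (b0 - b)) + (a + b - (d' + b'))).
    by rewrite (le_trans (ler_normD _ _))// lerD// ltW.
  rewrite scalerBr !opprD (addrACA (_ *: a)) -[LHS]addrA -[RHS]addrA; congr (_ + _).
  by rewrite (addrACA a b) [RHS]addrCA (addrA (b0 - b)) subrK.
(* A bound on the distance between two points of [K]. Once it is below [n.+1%:R * (e / 2)], it fits
   in the half of the error that [telescope] leaves free. *)
pose L := (`|M| + 1) *+ 2.
have [n Ln] : exists m, L < m.+1%:R * (e / 2).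
  have := archi_boundP (_ : 0 <= L / (e / 2)).
  rewrite divr_ge0 ?mulrn_wge0 ?addr_ge0// ?divr_ge0 ?ltW// => /(_ isT).
  rewrite ltr_pdivrMr ?divr_gt0//; set m := Num.bound _ => Lm.
  by exists m; rewrite (lt_le_trans Lm)// ler_pM2r ?divr_gt0// ler_nat.
have [d [b [Dd Kb le_e]]] := telescope n.
exists d => //; rewrite -(ltr_pM2l (ltr0Sn R n)).
rewrite -[X in X * `|_|]ger0_norm// -normrZ.
rewrite -[_ *: _](addrK (b0 - b)) (le_lt_trans (ler_normB _ _))//.
have : `|b0 - b| <= L.
  by rewrite (le_trans (ler_normB _ _))// /L mulr2n lerD ?KM.
lra.
Qed.

(** The cone moves from [B] to [D]: as [D] absorbs [C], the sum [D + (K + C)] lies in [D + K], while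
    [0] in [C] puts [K] inside [B]. Only the bounded set [K] is left to cancel. *)
Lemma sub_of_closed_minkowski_sum_sub (R : realType) (d : nat)
    (C A B D : set 'rV[R]_d) :
  C 0 -> convex_set D -> D = closure (minkowski_sum D C) ->
  has_compact_component C B ->
  closed_minkowski_sum A B `<=` closed_minkowski_sum D B -> A `<=` D.
Proof.
move=> C0 Dcvx DC [K [K0 Kcpt _ BE]] AB_DB a Aa.
have Dcl : closed D by rewrite DC; exact: closed_closure.
rewrite ((closure_id D).1 Dcl).
apply: (closure_cancel _ _ D K) => // [|b Kb]; first exact: compact_bounded.
suff /closureS : minkowski_sum D B `<=` minkowski_sum D K.
  apply; apply/AB_DB/subset_closure; exists a => //; exists b => //.
  by rewrite BE; exists b => //; exists 0; rewrite ?addr0.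
move=> _ [x Dx [y + <-]]; rewrite BE => -[k Kk [c Cc <-{y}]].
exists (x + c); last by exists k => //; rewrite addrAC addrA.
by rewrite DC; apply: subset_closure; exists x => //; exists c.
Qed.

Theorem proposition3p4 (R : realType) (d : nat) (C A B D : set 'rV[R]_d)
  (C_nonempty : C !=set0) (C_closed : closed C)
  (C_convex : convex_set C) (C_cone : cone C)
  (C_neq0 : C <> [set 0]) (C_neqT : C <> setT)
  (A_nonempty : A !=set0) (A_closed : closed A) (A_convex : convex_set A)
  (B_nonempty : B !=set0) (B_closed : closed B) (B_convex : convex_set B)
  (D_nonempty : D !=set0) (D_closed : closed D) (D_convex : convex_set D)
  (A_absorbs : A = closure (minkowski_sum A C))
  (B_absorbs : B = closure (minkowski_sum B C))
  (D_absorbs : D = closure (minkowski_sum D C))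
  (B_component : has_compact_component C B) :
  closed_minkowski_sum A B = closed_minkowski_sum D B -> A = D.
Proof.
move=> eqAB; have C0 := closed_cone0 _ _ _ C_nonempty C_closed C_cone.
apply/seteqP; split; apply: (sub_of_closed_minkowski_sum_sub _ _ C _ B) => //;
  by rewrite eqAB.
Qed.
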